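(* Let $k$ be an algebraically closed field, $G$ a finite abelian group with $\operatorname{char}(k)\nmid|G|$ acting on a $k$-algebra $A$ by $k$-algebra automorphisms, $g\mapsto\chi_g$ a fixed isomorphism $G\to G^\vee$, and $\mu$ a normalised 2-cocycle of $G$ with values in $k^\times$. As an $(A^{G,\mu},A^{G,\mu})$-bimodule there is a decomposition $$AG_\mu\cong\bigoplus_{g\in G}{}^{\mathrm{id}}(A^{G,\mu})^{\phi_g}$$ for some automorphisms $\phi_g$ of $A^{G,\mu}$, with $\phi_e=\mathrm{id}$. Each summand is free as a left and as a right $A^{G,\mu}$-module. Consequently $AG_\mu$ is a faithfully flat extension of both $A^{G,\mu}$ and $A$, on both the left and the right.
   Context: $G^\vee=\operatorname{Hom}(G,k^\times)$. The action of $g\in G$ on $a\in A$ is written $a^g$. The action induces a $G$-grading $A=\bigoplus_{g\in G}A_g$ with $A_g=\{a\in A:a^h=\chi_{g^{-1}}(h)a\text{ for all }h\in G\}$. A normalised 2-cocycle is a function $\mu:G\times G\to k^\times$ with $\mu(g,h)\mu(gh,l)=\mu(g,hl)\mu(h,l)$ and $\mu(e,g)=\mu(g,e)=1$ for all $g,h,l\in G$. The cocycle twist $A^{G,\mu}$ is the vector space $A$ with multiplication $a\ast_\mu b=\mu(g,h)ab$ for $a\in A_g$, $b\in A_h$, extended bilinearly. $kG_\mu$ is the twisted group algebra: the vector space with basis $G$ and multiplication $g\cdot h=\mu(g,h)gh$. $AG_\mu=A\otimes_kkG_\mu$. $G$ acts on $kG_\mu$ by $g^h=\chi_g(h)g$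 and on $AG_\mu$ diagonally: $(a\otimes g)^h=\chi_g(h)\,a^h\otimes g$. The algebra $A^{G,\mu}$ is identified with the fixed subring $(AG_\mu)^G$ of $AG_\mu$ (an element $a\in A_g$ corresponding to $a\otimes g$), which gives the bimodule structure on $AG_\mu$; $A$ is embedded in $AG_\mu$ as $A\otimes e$. For an algebra $B$ and a $k$-algebra automorphism $\phi$ of $B$, ${}^{\mathrm{id}}B^{\phi}$ denotes the $(B,B)$-bimodule $B$ with the usual left action and right action $m\cdot b=m\phi(b)$. *)

(* Defs.v *)
From HB Require Import structures.
From mathcomp Require Import all_boot all_order all_algebra all_fingroup.
From mathcomp Require Import boolp.
From mathcomp.multinomials Require Import freeg.

Set Implicit Arguments.
Unset Strict Implicit.
Unset Printing Implicit Defensive.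

Import GRing.Theory.
Local Open Scope ring_scope.

(* Right modules over R are left modules over the converse ring R^c: for
   n : N with N : lmodType R^c, the element usually written n.r is r *: n. *)

HB.mixin Record Lmodule_isBimodule (B C : pzRingType) M of GRing.Lmodule B M := {
  mactr : M -> C -> M;
  mactrA : forall m c d, mactr (mactr m c) d = mactr m (c * d);
  mactr1 : forall m, mactr m 1 = m;
  mactrDl : forall m n c, mactr (m + n) c = mactr m c + mactr n c;
  mactrDr : forall m c d, mactr m (c + d) = mactr m c + mactr m d;
  mactrZ : forall (b : B) m c, mactr (b *: m) c = b *: mactr m c
}.
#[short(type="bimodType")]
HB.structure Definition Bimodule (B C : pzRingType) :=
  {M of GRing.Lmodule B M & Lmodule_isBimodule B C M}.

Definition bimod_isom (B C : pzRingType) (M N : bimodType B C) : Prop :=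
  exists f : {linear M -> N},
    bijective f /\ forall (m : M) (c : C), f (mactr m c) = mactr (f m) c.

Definition rmod (B C : pzRingType) (M : bimodType B C) : Type := M.

Section Rmod.
Variables (B C : pzRingType) (M : bimodType B C).
HB.instance Definition _ := GRing.Zmodule.on (rmod M).
Let rscale (c : C^c) (m : rmod M) : rmod M := mactr (m : M) (c : C).
Fact rmod_scaleA (c d : C^c) m : rscale c (rscale d m) = rscale (c * d) m.
Proof. exact: mactrA. Qed.
Fact rmod_scale1 : left_id 1 rscale.
Proof. exact: mactr1. Qed.
Fact rmod_scaleDr : right_distributive rscale +%R.
Proof. by move=> c m n; exact: mactrDl. Qed.
Fact rmod_scaleDl m : {morph rscale^~ m : c d / c + d}.
Proof. by move=> c d; exact: mactrDr. Qed.
HB.instance Definition _ := GRing.Zmodule_isLmodule.Build C^c (rmod M)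
  rmod_scaleA rmod_scale1 rmod_scaleDr rmod_scaleDl.
Lemma rmod_scaleE (c : C^c) (m : rmod M) : c *: m = mactr (m : M) (c : C) :> M.
Proof. by []. Qed.
End Rmod.

(* S as a (B, B)-bimodule by restriction along a ring morphism f : B -> S. *)
Definition restr (B S : pzRingType) (f : {rmorphism B -> S}) : Type := S.

Section Restr.
Variables (B S : pzRingType) (f : {rmorphism B -> S}).
HB.instance Definition _ := GRing.Zmodule.on (restr f).
Let lscale (b : B) (s : restr f) : restr f := f b * (s : S).
Let rscale (s : restr f) (b : B) : restr f := (s : S) * f b.
Fact restr_scaleA a b s : lscale a (lscale b s) = lscale (a * b) s.
Proof. by rewrite /lscale rmorphM mulrA. Qed.
Fact restr_scale1 : left_id 1 lscale.
Proof. by move=> s; rewrite /lscale rmorph1 mul1r. Qed.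
Fact restr_scaleDr : right_distributive lscale +%R.
Proof. by move=> b s t; exact: mulrDr. Qed.
Fact restr_scaleDl s : {morph lscale^~ s : a b / a + b}.
Proof. by move=> a b; rewrite /lscale rmorphD; exact: mulrDl. Qed.
HB.instance Definition _ := GRing.Zmodule_isLmodule.Build B (restr f)
  restr_scaleA restr_scale1 restr_scaleDr restr_scaleDl.
Fact restr_mactrA s a b : rscale (rscale s a) b = rscale s (a * b).
Proof. by rewrite /rscale rmorphM mulrA. Qed.
Fact restr_mactr1 s : rscale s 1 = s.
Proof. by rewrite /rscale rmorph1 mulr1. Qed.
Fact restr_mactrDl s t b : rscale (s + t) b = rscale s b + rscale t b.
Proof. exact: mulrDl. Qed.
Fact restr_mactrDr s a b : rscale s (a + b) = rscale s a + rscale s b.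
Proof. by rewrite /rscale rmorphD; exact: mulrDr. Qed.
Fact restr_mactrZ (b : B) (s : restr f) (c : B) :
  rscale (b *: s) c = b *: rscale s c.
Proof. by rewrite /rscale /GRing.scale /= /lscale mulrA. Qed.
HB.instance Definition _ := Lmodule_isBimodule.Build B B (restr f)
  restr_mactrA restr_mactr1 restr_mactrDl restr_mactrDr restr_mactrZ.
Lemma restr_scaleE (b : B) (s : restr f) : b *: s = f b * (s : S) :> S.
Proof. by []. Qed.
Lemma restr_mactrE (s : restr f) (b : B) : mactr s b = (s : S) * f b :> S.
Proof. by []. Qed.
End Restr.

(* The bimodule ^id B^phi. *)
Definition idtwist (B : pzRingType) (phi : {rmorphism B -> B}) : Type := B.

Section IdTwist.
Variables (B : pzRingType) (phi : {rmorphism B -> B}).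
HB.instance Definition _ := GRing.Zmodule.on (idtwist phi).
Let lscale (b : B) (m : idtwist phi) : idtwist phi := b * (m : B).
Let rscale (m : idtwist phi) (b : B) : idtwist phi := (m : B) * phi b.
Fact idtwist_scaleA a b m : lscale a (lscale b m) = lscale (a * b) m.
Proof. exact: mulrA. Qed.
Fact idtwist_scale1 : left_id 1 lscale.
Proof. by move=> m; exact: mul1r. Qed.
Fact idtwist_scaleDr : right_distributive lscale +%R.
Proof. by move=> b m n; exact: mulrDr. Qed.
Fact idtwist_scaleDl m : {morph lscale^~ m : a b / a + b}.
Proof. by move=> a b; exact: mulrDl. Qed.
HB.instance Definition _ := GRing.Zmodule_isLmodule.Build B (idtwist phi)
  idtwist_scaleA idtwist_scale1 idtwist_scaleDr idtwist_scaleDl.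
Fact idtwist_mactrA m a b : rscale (rscale m a) b = rscale m (a * b).
Proof. by rewrite /rscale rmorphM mulrA. Qed.
Fact idtwist_mactr1 m : rscale m 1 = m.
Proof. by rewrite /rscale rmorph1 mulr1. Qed.
Fact idtwist_mactrDl m n b : rscale (m + n) b = rscale m b + rscale n b.
Proof. exact: mulrDl. Qed.
Fact idtwist_mactrDr m a b : rscale m (a + b) = rscale m a + rscale m b.
Proof. by rewrite /rscale rmorphD; exact: mulrDr. Qed.
Fact idtwist_mactrZ (b : B) (m : idtwist phi) (c : B) :
  rscale (b *: m) c = b *: rscale m c.
Proof. by rewrite /rscale /GRing.scale /= /lscale mulrA. Qed.
HB.instance Definition _ := Lmodule_isBimodule.Build B B (idtwist phi)
  idtwist_mactrA idtwist_mactr1 idtwist_mactrDl idtwist_mactrDr idtwist_mactrZ.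
Lemma idtwist_scaleE (b : B) (m : idtwist phi) : b *: m = b * (m : B) :> B.
Proof. by []. Qed.
Lemma idtwist_mactrE (m : idtwist phi) (b : B) : mactr m b = (m : B) * phi b :> B.
Proof. by []. Qed.
End IdTwist.

Definition dsum (B C : pzRingType) (I : finType) (M : I -> bimodType B C)
  : Type := {dffun forall i : I, M i}.

Section DirectSum.
Variables (B C : pzRingType) (I : finType) (M : I -> bimodType B C).
HB.instance Definition _ := Choice.on (dsum M).
Implicit Types x y z : {dffun forall i : I, M i}.
Let add x y : {dffun forall i : I, M i} := [ffun i => x i + y i].
Let opp x : {dffun forall i : I, M i} := [ffun i => - x i].
Let zero : {dffun forall i : I, M i} := [ffun i => 0].
Let lscale (b : B) x : {dffun forall i : I, M i} := [ffun i => b *: x i].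
Let rscale x (c : C) : {dffun forall i : I, M i} := [ffun i => mactr (x i) c].
Fact dsum_addA : associative add.
Proof. by move=> x y z; apply/ffunP=> i; rewrite !ffunE addrA. Qed.
Fact dsum_addC : commutative add.
Proof. by move=> x y; apply/ffunP=> i; rewrite !ffunE addrC. Qed.
Fact dsum_add0 : left_id zero add.
Proof. by move=> x; apply/ffunP=> i; rewrite !ffunE add0r. Qed.
Fact dsum_addN : left_inverse zero opp add.
Proof. by move=> x; apply/ffunP=> i; rewrite !ffunE addNr. Qed.
HB.instance Definition _ := GRing.isZmodule.Build (dsum M)
  dsum_addA dsum_addC dsum_add0 dsum_addN.
Fact dsum_scaleA a b x : lscale a (lscale b x) = lscale (a * b) x.
Proof. by apply/ffunP=> i; rewrite !ffunE scalerA. Qed.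
Fact dsum_scale1 : left_id 1 lscale.
Proof. by move=> x; apply/ffunP=> i; rewrite !ffunE scale1r. Qed.
Fact dsum_scaleDr : right_distributive lscale add.
Proof. by move=> b x y; apply/ffunP=> i; rewrite !ffunE scalerDr. Qed.
Fact dsum_scaleDl x a b : lscale (a + b) x = add (lscale a x) (lscale b x).
Proof. by apply/ffunP=> i; rewrite !ffunE scalerDl. Qed.
HB.instance Definition _ := GRing.Zmodule_isLmodule.Build B (dsum M)
  dsum_scaleA dsum_scale1 dsum_scaleDr dsum_scaleDl.
Fact dsum_mactrA x a b : rscale (rscale x a) b = rscale x (a * b).
Proof. by apply/ffunP=> i; rewrite !ffunE mactrA. Qed.
Fact dsum_mactr1 x : rscale x 1 = x.
Proof. by apply/ffunP=> i; rewrite !ffunE mactr1. Qed.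
Fact dsum_mactrDl x y c : rscale (add x y) c = add (rscale x c) (rscale y c).
Proof. by apply/ffunP=> i; rewrite !ffunE mactrDl. Qed.
Fact dsum_mactrDr x a b : rscale x (a + b) = add (rscale x a) (rscale x b).
Proof. by apply/ffunP=> i; rewrite !ffunE mactrDr. Qed.
Fact dsum_mactrZ b x c : rscale (lscale b x) c = lscale b (rscale x c).
Proof. by apply/ffunP=> i; rewrite !ffunE mactrZ. Qed.
HB.instance Definition _ := Lmodule_isBimodule.Build B C (dsum M)
  dsum_mactrA dsum_mactr1 dsum_mactrDl dsum_mactrDr dsum_mactrZ.
Lemma dsum_addE (x y : dsum M) i :
  (x + y : dsum M) i = x i + y i.
Proof. by rewrite ffunE. Qed.
Lemma dsum_scaleE (b : B) (x : dsum M) i :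
  (b *: x : dsum M) i = b *: (x i).
Proof. by rewrite ffunE. Qed.
Lemma dsum_mactrE (x : dsum M) (c : C) i :
  (mactr x c : dsum M) i = mactr (x i) c.
Proof. by rewrite ffunE. Qed.
End DirectSum.

Definition is_basis (R : pzRingType) (M : lmodType R) (I : choiceType)
    (b : I -> M) : Prop :=
  (forall m : M, exists (s : seq I) (c : I -> R), m = \sum_(i <- s) c i *: b i)
  /\ (forall (s : seq I) (c : I -> R), uniq s ->
        \sum_(i <- s) c i *: b i = 0 -> forall i, i \in s -> c i = 0).

Definition free_module (R : pzRingType) (M : lmodType R) : Prop :=
  exists (I : choiceType) (b : I -> M), is_basis b.

Section Tensor.
Variables (R : pzRingType) (N : lmodType R^c) (M : lmodType R).

Definition pretens (n : N) (m : M) : {freeg (N * M)%type / int} := << (n, m) >>.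

Inductive tensor_rel : {freeg (N * M)%type / int} -> Prop :=
| TensorRel0 : tensor_rel 0
| TensorRelB x y : tensor_rel x -> tensor_rel y -> tensor_rel (x - y)
| TensorRelDl n n' m :
    tensor_rel (pretens (n + n') m - pretens n m - pretens n' m)
| TensorRelDr n m m' :
    tensor_rel (pretens n (m + m') - pretens n m - pretens n m')
| TensorRelZ n (r : R) m :
    tensor_rel (pretens ((r : R^c) *: n) m - pretens n (r *: m)).

Definition tensor_relb : {pred {freeg (N * M)%type / int}} :=
  fun x => `[< tensor_rel x >].

Fact tensor_relb_closed : zmod_closed tensor_relb.
Proof.
split=> [|x y /asboolP xP /asboolP yP]; apply/asboolP; first exact: TensorRel0.
exact: TensorRelB.
Qed.
HB.instance Definition _ :=
  GRing.isZmodClosed.Build _ tensor_relb tensor_relb_closed.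

Definition tensor : zmodType := ring_quotient.Quotient.quot tensor_relb.

Definition pi_tensor (x : {freeg (N * M)%type / int}) : tensor :=
  (\pi_(ring_quotient.Quotient.quot tensor_relb) x)%qT.

Fact pi_tensor_is_zmod_morphism : zmod_morphism pi_tensor.
Proof. by move=> x y; rewrite /pi_tensor [LHS]raddfB. Qed.
HB.instance Definition _ := GRing.isZmodMorphism.Build _ _ pi_tensor
  pi_tensor_is_zmod_morphism.

Definition tens (n : N) (m : M) : tensor := pi_tensor (pretens n m).

Lemma pi_tensor_eq0 x : pi_tensor x = 0 <-> tensor_rel x.
Proof.
rewrite -[0](raddf0 pi_tensor) -[x in tensor_rel x]subr0; split=> [/eqP|xP].
  by rewrite -[_ == _]ring_quotient.Quotient.idealrBE => /asboolP.
apply/eqP; rewrite -[_ == _]ring_quotient.Quotient.idealrBE.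
exact/asboolP.
Qed.

Lemma pi_tensor_surj (t : tensor) : exists x, t = pi_tensor x.
Proof. by exists (generic_quotient.repr t); rewrite /pi_tensor generic_quotient.reprK. Qed.

Lemma tensDl n n' m : tens (n + n') m = tens n m + tens n' m.
Proof.
apply/eqP; rewrite -subr_eq0 opprD addrA -!raddfB.
exact/eqP/pi_tensor_eq0/TensorRelDl.
Qed.

Lemma tensDr n m m' : tens n (m + m') = tens n m + tens n m'.
Proof.
apply/eqP; rewrite -subr_eq0 opprD addrA -!raddfB.
exact/eqP/pi_tensor_eq0/TensorRelDr.
Qed.

Lemma tensZ n (r : R) m : tens ((r : R^c) *: n) m = tens n (r *: m).
Proof.
apply/eqP; rewrite -subr_eq0 -raddfB.
exact/eqP/pi_tensor_eq0/TensorRelZ.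
Qed.

Lemma pretens_ind (P : {freeg (N * M)%type / int} -> Prop) :
  P 0 -> (forall x y, P x -> P y -> P (x - y)) ->
  (forall n m, P (pretens n m)) -> forall x, P x.
Proof.
move=> P0 PB Pt x; have PN y : P y -> P (- y).
  by move=> Py; rewrite -sub0r; exact: PB.
have PD y z : P y -> P z -> P (y + z).
  by move=> Py Pz; rewrite -[z in _ + z]opprK; apply: PB => //; exact: PN.
have PMn y k : P y -> P (y *+ k).
  by move=> Py; elim: k => [|k IHk]; rewrite ?mulr0n // mulrS; exact: PD.
rewrite -[x]freeg_sumE; elim/big_ind: _ => // -[n m] _.
have -> : << coeff (n, m) x *g (n, m) >> = pretens n m *~ coeff (n, m) x.
  by rewrite freegU_mulz intz.
by case: (coeff _ x) => k; rewrite ?NegzE ?mulrNz; [|apply: PN]; exact: PMn.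
Qed.

Section Lift.
Variables (P : zmodType) (beta : N -> M -> P).
Hypotheses (betaDl : forall n n' m, beta (n + n') m = beta n m + beta n' m)
  (betaDr : forall n m m', beta n (m + m') = beta n m + beta n m')
  (betaZ : forall n (r : R) m, beta ((r : R^c) *: n) m = beta n (r *: m)).

Lemma tensor_lift : exists F : {additive tensor -> P},
  forall n m, F (tens n m) = beta n m.
Proof.
pose b : {freeg (N * M)%type / int} -> zmodule P :=
  fglift (fun p : N * M => beta p.1 p.2 : zmodule P).
have bB x y : b (x - y) = b x - b y by exact: lift_is_additive.
have bt n m : b (pretens n m) = beta n m by rewrite /b liftU scale1r.
have brel x : tensor_rel x -> b x = 0.
  elim=> [|{}x y _ bx _ by_|n n' m|n m m'|n r m].
  - by rewrite -(subrr 0) bB subrr.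
  - by rewrite bB bx by_ subrr.
  - by rewrite !bB !bt betaDl addrAC addrK subrr.
  - by rewrite !bB !bt betaDr addrAC addrK subrr.
  - by rewrite bB !bt betaZ subrr.
have bpi x : b (generic_quotient.repr (pi_tensor x)) = b x.
  apply/eqP; rewrite -subr_eq0 -bB; apply/eqP/brel/pi_tensor_eq0.
  by rewrite raddfB /= {1}/pi_tensor generic_quotient.reprK subrr.
pose F (t : tensor) : P := b (generic_quotient.repr t).
have FB : zmod_morphism F.
  move=> s t; have [x ->] := pi_tensor_surj s; have [y ->] := pi_tensor_surj t.
  by rewrite -raddfB /F !bpi bB.
pose Fm := GRing.isZmodMorphism.Build _ _ F FB.
exists (HB.pack F Fm : {additive tensor -> P}) => n m.
by rewrite /= /F bpi bt.
Qed.
End Lift.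

Lemma tensor_ext (P : zmodType) (F F' : {additive tensor -> P}) :
  (forall n m, F (tens n m) = F' (tens n m)) -> F =1 F'.
Proof.
move=> FF' t; have [x ->] := pi_tensor_surj t.
elim/pretens_ind: x => [|x y ex ey|n m]; first by rewrite !raddf0.
  by rewrite !raddfB /= ex ey.
exact: FF'.
Qed.
End Tensor.

Section TensorMap.
Variables (R : pzRingType) (N N' : lmodType R^c) (M M' : lmodType R).
Variables (f : {linear N -> N'}) (g : {linear M -> M'}).

(* f (x) g, characterised by tensmapE. *)
Definition tensmap : tensor N M -> tensor N' M' := fun t =>
  pi_tensor (fglift (fun p : N * M => pretens (f p.1) (g p.2)) (generic_quotient.repr t)).

Lemma tensmap_pi x : tensmap (pi_tensor x) =
  pi_tensor (fglift (fun p : N * M => pretens (f p.1) (g p.2)) x).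
Proof.
pose h := fglift (fun p : N * M => pretens (f p.1) (g p.2)).
have hB y z : h (y - z) = h y - h z by exact: lift_is_additive.
have ht n m : h (pretens n m) = pretens (f n) (g m) by rewrite /h liftU scale1r.
have hrel y : tensor_rel y -> tensor_rel (h y).
  elim=> [|{}y z _ hy _ hz|n n' m|n m m'|n r m].
  - by rewrite -(subrr 0) hB subrr; exact: TensorRel0.
  - by rewrite hB; exact: TensorRelB.
  - by rewrite !hB !ht linearD; exact: TensorRelDl.
  - by rewrite !hB !ht linearD; exact: TensorRelDr.
  - by rewrite !hB !ht !linearZ; exact: TensorRelZ.
apply/eqP; rewrite -subr_eq0 -raddfB -hB; apply/eqP/pi_tensor_eq0/hrel.
by apply/pi_tensor_eq0; rewrite raddfB /= {1}/pi_tensor generic_quotient.reprK subrr.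
Qed.

Lemma tensmapE n m : tensmap (tens n m) = tens (f n) (g m).
Proof. by rewrite tensmap_pi liftU scale1r. Qed.

Fact tensmap_is_zmod_morphism : zmod_morphism tensmap.
Proof.
move=> s t; have [x ->] := pi_tensor_surj s; have [y ->] := pi_tensor_surj t.
by rewrite -raddfB !tensmap_pi lift_is_additive raddfB.
Qed.
HB.instance Definition _ := GRing.isZmodMorphism.Build _ _ tensmap
  tensmap_is_zmod_morphism.
End TensorMap.

Definition exact_seq (X Y Z : zmodType) (f : X -> Y) (g : Y -> Z) : Prop :=
  forall y : Y, g y = 0 <-> exists x : X, y = f x.

(* A left module M is faithfully flat if a sequence N1 -> N2 -> N3 of right
   modules is exact if and only if its tensor product with M is. *)
Definition faithfully_flat_left (R : pzRingType) (M : lmodType R) : Prop :=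
  forall (N1 N2 N3 : lmodType R^c)
         (f : {linear N1 -> N2}) (g : {linear N2 -> N3}),
  exact_seq f g <->
  exact_seq (tensmap f (idfun : {linear M -> M}))
            (tensmap g (idfun : {linear M -> M})).

Definition faithfully_flat_right (R : pzRingType) (N : lmodType R^c) : Prop :=
  forall (M1 M2 M3 : lmodType R)
         (f : {linear M1 -> M2}) (g : {linear M2 -> M3}),
  exact_seq f g <->
  exact_seq (tensmap (idfun : {linear N -> N}) f)
            (tensmap (idfun : {linear N -> N}) g).

Section Data.
Variables (k : fieldType) (gT : finGroupType).

(* The elements of Hom(G, k^x), as functions to k. *)
Definition is_lchar (f : gT -> k) : Prop :=
  (forall g, f g != 0) /\ (forall g h, f (g * h)%g = f g * f h).

(* chi is an isomorphism from G to Hom(G, k^x). *)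
Definition is_dual_iso (chi : gT -> gT -> k) : Prop :=
  [/\ forall g, is_lchar (chi g),
      forall g h l, chi (g * h)%g l = chi g l * chi h l,
      forall g h, chi g =1 chi h -> g = h
    & forall f, is_lchar f -> exists g, chi g =1 f].

Definition is_cocycle2 (mu : gT -> gT -> k) : Prop :=
  [/\ forall g h, mu g h != 0,
      forall g h l, mu g h * mu (g * h)%g l = mu g (h * l)%g * mu h l
    & forall g, mu 1%g g = 1 /\ mu g 1%g = 1].

(* A right action a^g = to a g on A by k-algebra automorphisms; bijectivity of
   each to^~ g follows from the action axioms. *)
Definition is_alg_action (A : algType k) (to : {action gT &-> A}) : Prop :=
  forall g, linear (to^~ g) /\ monoid_morphism (to^~ g).
End Data.

(* The algebra A G_mu = A (x) kG_mu, on the space A^G: the element a (x) g is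
   the function with value a at g and 0 elsewhere. The twisted group algebra
   kG_mu itself is the case A = k. *)
Definition twgrp (k : fieldType) (gT : finGroupType) (A : algType k)
  (mu : gT -> gT -> k) (muP : is_cocycle2 mu) : Type := {ffun gT -> A}.

Section TwistedGroupAlgebra.
Variables (k : fieldType) (gT : finGroupType) (A : algType k).
Variables (mu : gT -> gT -> k) (muP : is_cocycle2 mu).
Local Notation AG := (twgrp A muP).

HB.instance Definition _ := GRing.Lmodule.on AG.

Definition tw_delta (g : gT) (a : A) : AG :=
  [ffun l => if l == g then a else 0].
Definition tw_one : AG := tw_delta 1%g 1.
Definition tw_mul (x y : AG) : AG :=
  [ffun l => \sum_g mu g (g^-1 * l)%g *: (x g * y (g^-1 * l)%g)].

Fact tw_mulA : associative tw_mul.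
Proof.
move=> x y z; apply/ffunP=> l; rewrite !ffunE.
transitivity (\sum_g \sum_h (mu g (h * (h^-1 * (g^-1 * l)))%g *
    mu h (h^-1 * (g^-1 * l))%g) *: (x g * y h * z (h^-1 * (g^-1 * l))%g)).
  apply: eq_bigr => g _; rewrite ffunE mulr_sumr scaler_sumr.
  apply: eq_bigr => h _.
  by rewrite -scalerAr scalerA mulrA mulKVg.
transitivity (\sum_h \sum_g (mu g (g^-1 * h)%g * mu h (h^-1 * l)%g) *:
   (x g * y (g^-1 * h)%g * z (h^-1 * l)%g)); last first.
  apply: eq_bigr => h _; rewrite ffunE mulr_suml scaler_sumr.
  by apply: eq_bigr => g _; rewrite -scalerAl scalerA mulrC.
rewrite [RHS]exchange_big /=; apply: eq_bigr => g _.
rewrite [RHS](reindex_inj (mulgI g)) /=; apply: eq_bigr => h _.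
case: muP => _ cc _.
by rewrite mulKg -cc invMg !mulgA.
Qed.

Fact tw_mul1 : left_id tw_one tw_mul.
Proof.
move=> x; apply/ffunP=> l; rewrite !ffunE (bigD1 1%g) //= big1 => [|g ne1].
  rewrite ffunE eqxx invg1 !mul1g mul1r addr0.
  by case: muP => _ _ /(_ l)[-> _]; rewrite scale1r.
by rewrite ffunE (negPf ne1) mul0r scaler0.
Qed.

Fact tw_mulr1 : right_id tw_one tw_mul.
Proof.
move=> x; apply/ffunP=> l; rewrite !ffunE (bigD1 l) //= big1 => [|g ne1].
  rewrite ffunE mulVg eqxx mulr1 addr0.
  by case: muP => _ _ /(_ l)[_ ->]; rewrite scale1r.
by rewrite ffunE -eq_invg_mul invgK (negPf ne1) mulr0 scaler0.
Qed.

Fact tw_mulDl : left_distributive tw_mul +%R.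
Proof.
move=> x y z; apply/ffunP=> l; rewrite !ffunE -big_split /=.
by apply: eq_bigr => g _; rewrite ffunE mulrDl scalerDr.
Qed.

Fact tw_mulDr : right_distributive tw_mul +%R.
Proof.
move=> x y z; apply/ffunP=> l; rewrite !ffunE -big_split /=.
by apply: eq_bigr => g _; rewrite ffunE mulrDr scalerDr.
Qed.

Fact tw_one_neq0 : tw_one != 0.
Proof. by apply/eqP => /ffunP/(_ 1%g)/eqP; rewrite !ffunE eqxx oner_eq0. Qed.

HB.instance Definition _ := GRing.Zmodule_isNzRing.Build AG
  tw_mulA tw_mul1 tw_mulr1 tw_mulDl tw_mulDr tw_one_neq0.

Fact tw_scaleAl (c : k) (x y : AG) : c *: (x * y) = (c *: x) * y.
Proof.
apply/ffunP=> l; rewrite !ffunE scaler_sumr; apply: eq_bigr => g _.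
by rewrite ffunE -scalerAl !scalerA mulrC.
Qed.
HB.instance Definition _ := GRing.Lmodule_isLalgebra.Build k AG tw_scaleAl.

Fact tw_scaleAr (c : k) (x y : AG) : c *: (x * y) = x * (c *: y).
Proof.
apply/ffunP=> l; rewrite !ffunE scaler_sumr; apply: eq_bigr => g _.
by rewrite ffunE -scalerAr !scalerA mulrC.
Qed.
HB.instance Definition _ := GRing.Lalgebra_isAlgebra.Build k AG tw_scaleAr.

Lemma twgrp_mulE (x y : AG) l :
  (x * y : AG) l = \sum_g mu g (g^-1 * l)%g *: (x g * y (g^-1 * l)%g).
Proof. by rewrite ffunE. Qed.

Lemma tw_deltaM g h a b :
  tw_delta g a * tw_delta h b = tw_delta (g * h)%g (mu g h *: (a * b)).
Proof.
apply/ffunP=> l; rewrite twgrp_mulE (bigD1 g) //= big1 => [|i ne].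
  rewrite !ffunE eqxx addr0 -(inj_eq (mulgI g)) mulKVg.
  by case: eqP => [->|_]; rewrite ?mulKg // mulr0 scaler0.
by rewrite !ffunE (negPf ne) mul0r scaler0.
Qed.
End TwistedGroupAlgebra.

(* twgrp A muP is the tensor product over k of the algebras A and kG_mu: it has
   the universal property for bilinear maps, and multiplies as it should. *)
Section TwgrpTensor.
Variables (k : fieldType) (gT : finGroupType) (A : algType k).
Variables (mu : gT -> gT -> k) (muP : is_cocycle2 mu).
Local Notation AG := (twgrp A muP).
Local Notation kG := (twgrp k^o muP).

Definition tw_tens (a : A) (x : kG) : AG := [ffun g => (x g : k) *: a].

Lemma tw_tens_delta a g : tw_tens a (tw_delta muP g 1) = tw_delta muP g a.
Proof.
apply/ffunP=> l; rewrite !ffunE.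
by case: eqP; rewrite ?scale1r ?scale0r.
Qed.

Lemma tw_tensM a b x y : tw_tens a x * tw_tens b y = tw_tens (a * b) (x * y).
Proof.
apply/ffunP=> l; rewrite twgrp_mulE ffunE twgrp_mulE scaler_suml.
apply: eq_bigr => g _; rewrite !ffunE -[in LHS]scalerAl -[in LHS]scalerAr !scalerA.
by [].
Qed.

Lemma twgrp_sum_delta (x : AG) : x = \sum_g tw_delta muP g (x g).
Proof.
apply/ffunP=> l; rewrite sum_ffunE (bigD1 l) //= big1 => [|g ne].
  by rewrite ffunE eqxx addr0.
by rewrite ffunE eq_sym (negPf ne).
Qed.

Lemma twgrp_universal (V : lmodType k) (f : A -> kG -> V) :
  (forall a, linear (f a)) -> (forall x, linear (f^~ x)) ->
  exists F : {linear AG -> V}, (forall a x, F (tw_tens a x) = f a x) /\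
    forall F' : {linear AG -> V}, (forall a x, F' (tw_tens a x) = f a x) ->
      F' =1 F.
Proof.
move=> fr fl; pose F (x : AG) : V := \sum_g f (x g) (tw_delta muP g 1).
have Flin : linear F.
  move=> c x y; rewrite /F scaler_sumr -big_split /=.
  by apply: eq_bigr => g _; rewrite !ffunE fl.
pose Fm := GRing.isLinear.Build _ _ _ _ F Flin.
pose FL : {linear AG -> V} := HB.pack F Fm.
exists FL; split=> [a x | F' F'E x]; last first.
  rewrite [x in LHS]twgrp_sum_delta raddf_sum; apply: eq_bigr => g _.
  by rewrite -[tw_delta muP g (x g)]tw_tens_delta; exact: F'E.
pose fa := GRing.isLinear.Build _ _ _ _ (f a) (fr a).
pose FA : {linear kG -> V} := HB.pack (f a) fa.
have -> : f a x = FA (\sum_g (x g : k) *: tw_delta muP g (1 : k^o)).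
  congr (FA _); apply/ffunP=> l; rewrite sum_ffunE (bigD1 l) //= big1.
    by rewrite !ffunE eqxx addr0 /GRing.scale /= mulr1.
  by move=> g ne; rewrite !ffunE eq_sym (negPf ne) scaler0.
rewrite raddf_sum; apply: eq_bigr => g _; rewrite ffunE.
rewrite [RHS](scalable_linear (fr a)).
by rewrite (scalable_linear (fl (tw_delta muP g 1))).
Qed.
End TwgrpTensor.

Section BaseEmbedding.
Variables (k : fieldType) (gT : finGroupType) (A : algType k).
Variables (mu : gT -> gT -> k) (muP : is_cocycle2 mu).
Local Notation AG := (twgrp A muP).

(* The embedding a |-> a (x) e of A in A G_mu. *)
Definition base_emb (a : A) : AG := tw_delta muP 1%g a.

Fact base_emb_linear : linear base_emb.
Proof.
move=> c a b; apply/ffunP=> g; rewrite !ffunE.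
by case: eqP; rewrite // scaler0 addr0.
Qed.
HB.instance Definition _ :=
  GRing.isLinear.Build k A AG _ base_emb base_emb_linear.
Fact base_emb_monoid : monoid_morphism base_emb.
Proof.
split=> [|a b] //; rewrite /base_emb tw_deltaM mulg1.
have [_ _ /(_ 1%g)[m _]] := muP.
by rewrite m scale1r.
Qed.
HB.instance Definition _ :=
  GRing.isMonoidMorphism.Build A AG base_emb base_emb_monoid.
End BaseEmbedding.
Arguments base_emb {k gT} A {mu} muP a.

Section Grading.
Variables (k : fieldType) (gT : finGroupType) (A : algType k).
Variables (to : {action gT &-> A}) (chi : gT -> gT -> k).

Definition grcomp (g : gT) (a : A) : Prop :=
  forall h, to a h = chi g^-1%g h *: a.

(* The projection onto A_g along the grading, see gproj_grcomp, gproj_sum and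
   gproj_id. *)
Definition gproj (g : gT) (a : A) : A :=
  (#|gT|%:R^-1 : k) *: \sum_h chi g h *: to a h.

Hypotheses (charG : [pchar k]^'.-nat #|gT|) (toP : is_alg_action to)
  (chiP : is_dual_iso chi).

Lemma cardG_neq0 : #|gT|%:R != 0 :> k.
Proof. by rewrite natf_neq0_pchar. Qed.

Lemma dual_neq0 g h : chi g h != 0.
Proof. by case: chiP => c _ _ _; case: (c g). Qed.
Lemma dualMr g h l : chi g (h * l)%g = chi g h * chi g l.
Proof. by case: chiP => c _ _ _; case: (c g). Qed.
Lemma dualMl g h l : chi (g * h)%g l = chi g l * chi h l.
Proof. by case: chiP. Qed.
Lemma dual1l h : chi 1%g h = 1.
Proof. by apply: (mulfI (dual_neq0 1 h)); rewrite -dualMl mulg1 mulr1. Qed.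
Lemma dual1r g : chi g 1%g = 1.
Proof. by apply: (mulfI (dual_neq0 g 1)); rewrite -dualMr mulg1 mulr1. Qed.
Lemma dualVl g h : chi g^-1%g h = (chi g h)^-1.
Proof.
apply: (mulfI (dual_neq0 g h)).
by rewrite -dualMl mulgV dual1l mulfV ?dual_neq0.
Qed.
Lemma dualVr g h : chi g h^-1%g = (chi g h)^-1.
Proof.
apply: (mulfI (dual_neq0 g h)).
by rewrite -dualMr mulgV dual1r mulfV ?dual_neq0.
Qed.

Lemma dual_sum_row g : \sum_h chi g h = if g == 1%g then #|gT|%:R else 0.
Proof.
case: eqP => [->|/eqP ne].
  by under eq_bigr do rewrite dual1l; rewrite sumr_const.
have [h nh] : exists h, chi g h != 1.
  apply/existsP; rewrite -negb_forall; apply: contra ne => /forallP c1.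
  case: chiP => _ _ inj _; apply/eqP/inj => h.
  by rewrite dual1l; apply/eqP/(contraTT _ (c1 h)) => /negP.
have : \sum_l chi g l = chi g h * \sum_l chi g l.
  rewrite mulr_sumr [LHS](reindex_inj (mulgI h)) /=.
  by apply: eq_bigr => l _; rewrite dualMr.
move/eqP; rewrite -[X in X == _]mul1r -subr_eq0 -mulrBl mulf_eq0 subr_eq0.
by rewrite eq_sym (negPf nh) => /eqP.
Qed.

Lemma dual_sum_col h : \sum_g chi g h = if h == 1%g then #|gT|%:R else 0.
Proof.
pose n : k := #|gT|%:R.
pose X := \matrix_(i < #|gT|, j < #|gT|) chi (enum_val i) (enum_val j).
pose Y := \matrix_(i < #|gT|, j < #|gT|)
            (n^-1 * (chi (enum_val j) (enum_val i))^-1).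
have XY : X *m Y = 1%:M.
  apply/matrixP=> i j; rewrite !mxE.
  transitivity (n^-1 * \sum_h chi (enum_val i * (enum_val j)^-1)%g h).
    rewrite mulr_sumr (reindex _ (onW_bij _ (enum_val_bij gT))) /=.
    by apply: eq_bigr => l _; rewrite !mxE dualMl dualVl mulrCA.
  rewrite dual_sum_row -eq_mulgV1 (inj_eq enum_val_inj).
  by case: eqP => _; rewrite ?mulr0 // mulVf ?cardG_neq0.
have /mulmx1C/matrixP/(_ (enum_rank 1%g) (enum_rank h)) := XY.
rewrite !mxE (inj_eq enum_rank_inj) eq_sym => e.
have {e}: n^-1 * \sum_g chi g h = (h == 1%g)%:R.
  rewrite -e mulr_sumr (reindex _ (onW_bij _ (enum_val_bij gT))) /=.
  by apply: eq_bigr => l _; rewrite !mxE !enum_rankK dual1r invr1 mulr1.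
move/(congr1 ( *%R n)); rewrite mulVKf ?cardG_neq0 // => ->.
by case: eqP; rewrite ?mulr1 ?mulr0.
Qed.

Lemma actT g h a : to a (g * h)%g = to (to a g) h.
Proof. by case: to => f [_ fM] /=; apply: fM; rewrite inE. Qed.
Lemma actT1 a : to a 1%g = a.
Proof.
by have := actT 1%g 1%g a; rewrite mulg1; case: to => f [inj _] /= /inj <-.
Qed.
Lemma act_linear g : linear (to^~ g). Proof. by case: (toP g). Qed.
Lemma act_sum g (I : finType) (F : I -> A) :
  to (\sum_i F i) g = \sum_i to (F i) g.
Proof.
pose fm := GRing.isLinear.Build _ _ _ _ _ (act_linear g).
exact: (raddf_sum (HB.pack (to^~ g) fm : {linear A -> A})).
Qed.
Lemma act_scale g c a : to (c *: a) g = c *: to a g.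
Proof.
exact: (scalable_linear (act_linear g)).
Qed.
Lemma act_mul g a b : to (a * b) g = to a g * to b g.
Proof. by case: (toP g) => _ []. Qed.
Lemma act_one g : to 1 g = 1.
Proof. by case: (toP g) => _ []. Qed.

Fact gproj_linear g : linear (gproj g).
Proof.
move=> c a b; rewrite /gproj scalerA mulrC -scalerA -scalerDr.
rewrite (scaler_sumr c) -big_split /=; congr (_ *: _).
apply: eq_bigr => h _; rewrite act_linear scalerDr !scalerA.
by rewrite mulrC.
Qed.

Lemma gproj_grcomp g a : grcomp g (gproj g a).
Proof.
move=> h; rewrite /gproj act_scale act_sum scalerA mulrC -scalerA.
congr (_ *: _); rewrite [in RHS](reindex_inj (mulIg h)) scaler_sumr /=.
apply: eq_bigr => l _; rewrite act_scale -actT dualMr dualVl scalerA mulrC.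
by rewrite mulfK ?dual_neq0.
Qed.

Lemma gproj_sum a : \sum_g gproj g a = a.
Proof.
rewrite -scaler_sumr exchange_big /= (bigD1 1%g) //= [X in _ + X]big1.
  rewrite -scaler_suml dual_sum_col eqxx addr0 actT1 scalerA mulVf ?scale1r //.
  exact: cardG_neq0.
by move=> h ne; rewrite -scaler_suml dual_sum_col (negPf ne) scale0r.
Qed.

Lemma gproj_id g h a : grcomp g a -> gproj h a = if h == g then a else 0.
Proof.
move=> ga; rewrite /gproj; under eq_bigr do rewrite ga scalerA -dualMl.
rewrite -scaler_suml dual_sum_row -eq_mulgV1.
by case: eqP; rewrite ?scale0r ?scaler0 // scalerA mulVf ?cardG_neq0 ?scale1r.
Qed.

Lemma grcompM g h a b : grcomp g a -> grcomp h b -> grcomp (g * h)%g (a * b).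
Proof.
move=> ga hb l; rewrite act_mul ga hb -scalerAl -scalerAr scalerA.
by rewrite !dualVl dualMl invfM.
Qed.

Lemma grcomp1 : grcomp 1%g 1.
Proof. by move=> h; rewrite act_one invg1 dual1l scale1r. Qed.
End Grading.

(* The cocycle twist A^{G,mu}: the space A with a new multiplication. The proofs
   are arguments so that its algebra structure can be inferred. *)
Definition cotwist (k : fieldType) (gT : finGroupType) (A : algType k)
  (charG : [pchar k]^'.-nat #|gT|)
  (to : {action gT &-> A}) (toP : is_alg_action to)
  (chi : gT -> gT -> k) (chiP : is_dual_iso chi)
  (mu : gT -> gT -> k) (muP : is_cocycle2 mu) : Type := A.

Section CocycleTwist.
Variables (k : fieldType) (gT : finGroupType) (A : algType k).
Variables (charG : [pchar k]^'.-nat #|gT|).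
Variables (to : {action gT &-> A}) (toP : is_alg_action to).
Variables (chi : gT -> gT -> k) (chiP : is_dual_iso chi).
Variables (mu : gT -> gT -> k) (muP : is_cocycle2 mu).
Local Notation B := (cotwist charG toP chiP muP).
Local Notation AG := (twgrp A muP).
Local Notation pr := (gproj to chi).

HB.instance Definition _ := GRing.Lmodule.on B.

(* The bilinear extension of a * b = mu(g,h) ab for a in A_g, b in A_h. *)
Definition ct_mul (a b : B) : B :=
  \sum_g \sum_h mu g h *: ((pr g a : A) * pr h b).

Lemma ct_mul_homog g h (a b : A) : grcomp to chi g a -> grcomp to chi h b ->
  ct_mul a b = mu g h *: (a * b).
Proof.
move=> ga hb; rewrite /ct_mul (bigD1 g) //= (bigD1 h) //=.
rewrite !(gproj_id charG chiP _ ga) !(gproj_id charG chiP _ hb) !eqxx.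
rewrite !big1 ?addr0 // => [l ne|l ne].
  apply: big1 => m _.
  by rewrite (gproj_id charG chiP _ ga) (negPf ne) mul0r scaler0.
by rewrite (gproj_id charG chiP _ hb) (negPf ne) mulr0 scaler0.
Qed.

(* The identification of A^{G,mu} with a subring of A G_mu: it is the linear
   map sending a in A_g to a (x) g. *)
Definition ct_emb (a : B) : AG := [ffun g => pr g a].

Lemma ct_emb_homog g (a : A) :
  grcomp to chi g a -> ct_emb a = tw_delta muP g a.
Proof.
move=> ga; apply/ffunP=> h; rewrite !ffunE (gproj_id charG chiP _ ga).
by [].
Qed.

Lemma ct_emb_inj : injective ct_emb.
Proof.
move=> a b /ffunP ab; rewrite -(gproj_sum to charG chiP a) -(gproj_sum to charG chiP b).
by apply: eq_bigr => g _; move: (ab g); rewrite !ffunE.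
Qed.

Fact ct_emb_linear : linear ct_emb.
Proof.
by move=> c a b; apply/ffunP=> g; rewrite !ffunE (gproj_linear _ toP).
Qed.

Fact ct_embM a b : ct_emb (ct_mul a b) = ct_emb a * ct_emb b.
Proof.
pose fm := GRing.isLinear.Build _ _ _ _ _ ct_emb_linear.
pose f : {linear B -> AG} := HB.pack ct_emb fm.
have E c : ct_emb c = \sum_g tw_delta muP g (pr g c).
  by rewrite [LHS]twgrp_sum_delta; apply: eq_bigr => g _; rewrite ffunE.
rewrite [ct_emb a]E [ct_emb b]E mulr_suml -[ct_emb _]/(f _) raddf_sum.
apply: eq_bigr => g _; rewrite raddf_sum mulr_sumr; apply: eq_bigr => h _.
rewrite [LHS](scalable_linear ct_emb_linear) tw_deltaM.
have gh := grcompM toP chiP (gproj_grcomp toP chiP g a) (gproj_grcomp toP chiP h b).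
rewrite (ct_emb_homog gh); apply/ffunP=> l; rewrite !ffunE.
by case: eqP; rewrite ?scaler0.
Qed.

Fact ct_emb1 : ct_emb (1 : A) = 1.
Proof. exact: ct_emb_homog (grcomp1 toP chiP). Qed.

Fact ct_mulA : associative ct_mul.
Proof. by move=> a b c; apply: ct_emb_inj; rewrite !ct_embM mulrA. Qed.
Fact ct_mul1 : left_id (1 : A) ct_mul.
Proof. by move=> a; apply: ct_emb_inj; rewrite ct_embM ct_emb1 mul1r. Qed.
Fact ct_mulr1 : right_id (1 : A) ct_mul.
Proof. by move=> a; apply: ct_emb_inj; rewrite ct_embM ct_emb1 mulr1. Qed.
Let ct_embD a b : ct_emb (a + b) = ct_emb a + ct_emb b.
Proof. by have := ct_emb_linear 1 a b; rewrite !scale1r. Qed.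
Fact ct_mulDl : left_distributive ct_mul +%R.
Proof.
by move=> a b c; apply: ct_emb_inj; rewrite ct_embD !ct_embM ct_embD mulrDl.
Qed.
Fact ct_mulDr : right_distributive ct_mul +%R.
Proof.
by move=> a b c; apply: ct_emb_inj; rewrite ct_embD !ct_embM ct_embD mulrDr.
Qed.
HB.instance Definition _ := GRing.Zmodule_isNzRing.Build B
  ct_mulA ct_mul1 ct_mulr1 ct_mulDl ct_mulDr (oner_neq0 A).

HB.instance Definition _ := GRing.isLinear.Build k B AG _ ct_emb ct_emb_linear.

HB.instance Definition _ :=
  GRing.isMonoidMorphism.Build B AG ct_emb (conj ct_emb1 ct_embM).

Fact ct_scaleAl (c : k) (a b : B) :
  c *: (a * b : B) = (c *: a : B) * b.
Proof. by apply: ct_emb_inj; rewrite linearZ !rmorphM /= scalerAl -[c *: ct_emb a]linearZ. Qed.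
HB.instance Definition _ := GRing.Lmodule_isLalgebra.Build k B ct_scaleAl.
Fact ct_scaleAr (c : k) (a b : B) :
  c *: (a * b : B) = a * (c *: b : B).
Proof. by apply: ct_emb_inj; rewrite linearZ !rmorphM /= scalerAr -[c *: ct_emb b]linearZ. Qed.
HB.instance Definition _ := GRing.Lalgebra_isAlgebra.Build k B ct_scaleAr.

(* The diagonal action (a (x) g)^h = chi_g(h) a^h (x) g. *)
Definition tw_act (x : AG) (h : gT) : AG := [ffun g => chi g h *: to (x g) h].

Lemma ct_emb_fixed (x : AG) :
  (exists a, x = ct_emb a) <-> forall h, tw_act x h = x.
Proof.
split=> [[a ->] h | fx].
  apply/ffunP=> g; rewrite !ffunE (gproj_grcomp toP chiP) dualVl // scalerA.
  by rewrite mulfV ?scale1r // (dual_neq0 chiP).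
have xg g : grcomp to chi g (x g).
  move=> h; move/ffunP/(_ g): (fx h); rewrite ffunE => {2}<-.
  by rewrite dualVl // scalerK // (dual_neq0 chiP).
exists (\sum_g x g); rewrite [LHS]twgrp_sum_delta raddf_sum.
by apply: eq_bigr => g _; rewrite /= (ct_emb_homog (xg g)).
Qed.
End CocycleTwist.
Arguments ct_emb {k gT A} charG {to} toP {chi} chiP {mu} muP a.

(* Main.v *)
(* The units u_g = 1 (x) g normalise A^{G,mu}: u_g b = phi_g(b) u_g, where phi_g
   scales A_h by mu(g,h) / mu(h,g). Since A_h (x) hg = A_h u_g up to the scalar
   mu(h,g), they also form a basis of A G_mu over A^{G,mu}, which gives the
   decomposition. Over A they form a basis that even commutes with A. Tensoring
   with a free module of finite nonzero rank is taking a finite power, so it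
   preserves and reflects exactness. *)
Require Import Defs.
From HB Require Import structures.
From mathcomp Require Import all_boot all_order all_algebra all_fingroup.
From mathcomp Require Import boolp.

Set Implicit Arguments.
Unset Strict Implicit.
Unset Printing Implicit Defensive.

Import GRing.Theory.
Local Open Scope ring_scope.


(** * Exactness of a sequence and of its power *)

(** The families [eX], [eY], [eZ] are coordinates of [X'], [Y'], [Z'] in the powers of [X], [Y], [Z]
    indexed by [I], and [f'], [g'] act coordinatewise. Exactness passes up one coordinate at a time;
    it passes down through constant families, read off at [i0]. *)
Lemma exact_seq_power (I : Type) (i0 : I) (X Y Z X' Y' Z' : zmodType)
    (f : X -> Y) (g : {additive Y -> Z}) (f' : X' -> Y') (g' : Y' -> Z')
    (eX : I -> X' -> X) (eY : I -> Y' -> Y) (eZ : I -> {additive Z' -> Z}) :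
  (forall i x, eY i (f' x) = f (eX i x)) ->
  (forall i y, eZ i (g' y) = g (eY i y)) ->
  (forall v : I -> X, exists x, forall i, eX i x = v i) ->
  (forall v : I -> Y, exists y, forall i, eY i y = v i) ->
  (forall y y', (forall i, eY i y = eY i y') -> y = y') ->
  (forall z, (forall i, eZ i z = 0) -> z = 0) ->
  exact_seq f g <-> exact_seq f' g'.
Proof.
move=> ef eg surX surY injY injZ; split=> ex y.
  split=> [gy0 | [x ->]].
    (* Preimages are chosen in all coordinates at once; [surX] assembles them into one element of
       [X']. *)
    have /choice[v vE] i : exists x, eY i y = f x.
      by apply/ex; rewrite -eg gy0 raddf0.
    have [x xE] := surX v.
    by exists x; apply: injY => i; rewrite ef xE.
  by apply: injZ => i; rewrite eg ef; apply/ex; exists (eX i x).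
have [y' y'E] := surY (fun=> y); split=> [gy0 | [x xE]].
  have /ex[x xE] : g' y' = 0 by apply: injZ => i; rewrite eg y'E.
  by exists (eX i0 x); rewrite -ef -xE.
have [x' x'E] := surX (fun=> x).
rewrite -(y'E i0) -eg.
have /ex -> : exists x, y' = f' x; last by rewrite raddf0.
by exists x'; apply: injY => i; rewrite ef y'E x'E.
Qed.

(** * Additivity of elementary tensors and induction on tensors *)

Section TensorBalanced.
Variables (R : pzRingType) (N : lmodType R^c) (M : lmodType R).

Lemma tens0l (m : M) : tens (0 : N) m = 0.
Proof. by apply: (addIr (tens 0 m)); rewrite -tensDl !add0r. Qed.

Lemma tens0r (n : N) : tens n (0 : M) = 0.
Proof. by apply: (addIr (tens n 0)); rewrite -tensDr !add0r. Qed.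

Lemma tensNl (n : N) (m : M) : tens (- n) m = - tens n m.
Proof. by apply: (addIr (tens n m)); rewrite -tensDl !addNr tens0l. Qed.

Lemma tensNr (n : N) (m : M) : tens n (- m) = - tens n m.
Proof. by apply: (addIr (tens n m)); rewrite -tensDr !addNr tens0r. Qed.

Lemma tens_suml (I : finType) (n : I -> N) (m : M) :
  tens (\sum_i n i) m = \sum_i tens (n i) m.
Proof.
by apply: (big_morph (fun n => tens n m)) => [? ?|]; rewrite ?tensDl ?tens0l.
Qed.

Lemma tens_sumr (I : finType) (n : N) (m : I -> M) :
  tens n (\sum_i m i) = \sum_i tens n (m i).
Proof.
by apply: (big_morph (tens n)) => [? ?|]; rewrite ?tensDr ?tens0r.
Qed.

(** The zero tensor needs no case of its own, being [tens 0 0]. *)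
Lemma tensor_ind (P : tensor N M -> Prop) :
  (forall s t, P s -> P t -> P (s - t)) -> (forall n m, P (tens n m)) ->
  forall t, P t.
Proof.
move=> PB Pt t; have [x ->] := pi_tensor_surj t.
elim/pretens_ind: x => [|x y Px Py|n m]; last exact: Pt.
  by rewrite raddf0 -(tens0l 0); exact: Pt.
by rewrite [pi_tensor _]raddfB; exact: PB.
Qed.
End TensorBalanced.

(** * Faithful flatness of finite free left modules *)

Section FiniteFreeLeft.
Variables (R : pzRingType) (M : lmodType R) (I : finType) (i0 : I).
Variables (b : I -> M) (c : I -> {linear M -> R^o}).
Hypotheses (cK : forall m, \sum_i (c i m : R) *: b i = m).
Hypothesis (cb : forall i j, c i (b j) = (i == j)%:R).

(** This is $\mathrm{id}\otimes c_i$ followed by $N\otimes_R R\cong N$; it is balanced because $c_i$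
    is left linear. *)
Lemma tensor_coordl (N : lmodType R^c) i :
  exists e : {additive tensor N M -> N},
  forall n m, e (tens n m) = (c i m : R^c) *: n.
Proof.
apply: (tensor_lift (beta := fun n m => (c i m : R^c) *: n))
  => [n n' m|n m m'|n r m].
- by rewrite scalerDr.
- by rewrite linearD scalerDl.
- by rewrite scalerA linearZ.
Qed.

Lemma finite_free_faithfully_flat_left : faithfully_flat_left M.
Proof.
move=> N1 N2 N3 f g.
(* The maps $e_i$ identify $N\otimes M$ with $N^I$: a family $v$ comes from $\sum_j v_j\otimes b_j$,
   and every tensor is recovered from its coordinates in this way. *)
have coord N : exists e : I -> {additive tensor N M -> N},
    [/\ forall i n m, e i (tens n m) = (c i m : R^c) *: n,
        forall v : I -> N, exists t, forall i, e i t = v i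
      & forall t, \sum_i tens (e i t) (b i) = t].
  have [e eE] := choice (tensor_coordl N); exists e; split=> // [v|].
    exists (\sum_j tens (v j) (b j)) => i; rewrite raddf_sum (bigD1 i) //=.
    rewrite eE cb eqxx scale1r big1 ?addr0 // => j /negPf ne.
    by rewrite eE cb eq_sym ne scale0r.
  elim/tensor_ind => [s t es et|n m].
    rewrite -[s in RHS]es -[t in RHS]et -sumrB; apply: eq_bigr => i _.
    by rewrite raddfB tensDl tensNl.
  rewrite -[m in RHS]cK tens_sumr; apply: eq_bigr => i _.
  by rewrite eE tensZ.
have [e1 [e1E sur1 K1]] := coord N1.
have [e2 [e2E sur2 K2]] := coord N2.
have [e3 [e3E _ K3]] := coord N3.
(* The identification is natural in $N$, so [tensmap h idfun] becomes [h] in each coordinate. *)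
have comm (N N' : lmodType R^c) (h : {linear N -> N'})
    (e : I -> {additive tensor N M -> N})
    (e' : I -> {additive tensor N' M -> N'}) :
    (forall i n m, e i (tens n m) = (c i m : R^c) *: n) ->
    (forall i n m, e' i (tens n m) = (c i m : R^c) *: n) ->
    forall i t, e' i (tensmap h (idfun : {linear M -> M}) t) = h (e i t).
  move=> eE e'E i; elim/tensor_ind => [s t hs ht|n m].
    by rewrite !raddfB /= hs ht.
  by rewrite tensmapE eE e'E linearZ.
apply: (exact_seq_power i0 (comm _ _ f _ _ e1E e2E)
  (comm _ _ g _ _ e2E e3E)) => //.
  by move=> y y' yy'; rewrite -(K2 y) -(K2 y');
    apply: eq_bigr => i _; rewrite yy'.
by move=> z z0; rewrite -(K3 z) big1 // => i _; rewrite z0 tens0l.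
Qed.
End FiniteFreeLeft.

(** * Faithful flatness of finite free right modules, the mirror image *)

Section FiniteFreeRight.
Variables (R : pzRingType) (N : lmodType R^c) (I : finType) (i0 : I).
Variables (b : I -> N) (c : I -> {linear N -> R^c^o}).
Hypotheses (cK : forall n, \sum_i (c i n : R^c) *: b i = n).
Hypothesis (cb : forall i j, c i (b j) = (i == j)%:R).

Lemma tensor_coordr (M : lmodType R) i :
  exists e : {additive tensor N M -> M},
  forall n m, e (tens n m) = (c i n : R) *: m.
Proof.
apply: (tensor_lift (beta := fun n m => (c i n : R) *: m))
  => [n n' m|n m m'|n r m].
- by rewrite linearD scalerDl.
- by rewrite scalerDr.
- by rewrite scalerA linearZ.
Qed.

Lemma finite_free_faithfully_flat_right : faithfully_flat_right N.
Proof.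
move=> M1 M2 M3 f g.
have coord M : exists e : I -> {additive tensor N M -> M},
    [/\ forall i n m, e i (tens n m) = (c i n : R) *: m,
        forall v : I -> M, exists t, forall i, e i t = v i
      & forall t, \sum_i tens (b i) (e i t) = t].
  have [e eE] := choice (tensor_coordr M); exists e; split=> // [v|].
    exists (\sum_j tens (b j) (v j)) => i; rewrite raddf_sum (bigD1 i) //=.
    rewrite eE cb eqxx scale1r big1 ?addr0 // => j /negPf ne.
    by rewrite eE cb eq_sym ne scale0r.
  elim/tensor_ind => [s t es et|n m].
    rewrite -[s in RHS]es -[t in RHS]et -sumrB; apply: eq_bigr => i _.
    by rewrite raddfB tensDr tensNr.
  rewrite -[n in RHS]cK tens_suml; apply: eq_bigr => i _.
  by rewrite eE -tensZ.
have [e1 [e1E sur1 K1]] := coord M1.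
have [e2 [e2E sur2 K2]] := coord M2.
have [e3 [e3E _ K3]] := coord M3.
have comm (M M' : lmodType R) (h : {linear M -> M'})
    (e : I -> {additive tensor N M -> M})
    (e' : I -> {additive tensor N M' -> M'}) :
    (forall i n m, e i (tens n m) = (c i n : R) *: m) ->
    (forall i n m, e' i (tens n m) = (c i n : R) *: m) ->
    forall i t, e' i (tensmap (idfun : {linear N -> N}) h t) = h (e i t).
  move=> eE e'E i; elim/tensor_ind => [s t hs ht|n m].
    by rewrite !raddfB /= hs ht.
  by rewrite tensmapE eE e'E linearZ.
apply: (exact_seq_power i0 (comm _ _ f _ _ e1E e2E)
  (comm _ _ g _ _ e2E e3E)) => //.
  by move=> y y' yy'; rewrite -(K2 y) -(K2 y');
    apply: eq_bigr => i _; rewrite yy'.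
by move=> z z0; rewrite -(K3 z) big1 // => i _; rewrite z0 tens0r.
Qed.
End FiniteFreeRight.

(** * Freeness of the twisted bimodules on both sides *)

Section FreeTwist.
Variables (B : pzRingType) (phi : {rmorphism B -> B}).

Lemma idtwist_free : free_module (idtwist phi).
Proof.
exists unit, (fun=> (1 : B)); split=> [m|s c].
  by exists [:: tt], (fun=> m); rewrite big_seq1 idtwist_scaleE mulr1.
(* A list over [unit] without repetition is empty or [[:: tt]]. *)
case: s => [|[] [|[] s]] //= _; rewrite big_seq1 idtwist_scaleE mulr1.
by move=> c0 [] _.
Qed.

(** Acting on 1 from the right by $b$ gives $\phi(b)$, so 1 is a basis exactly because $\phi$ can be
    inverted: the coefficient of $m$ is $\phi^{-1}(m)$. *)
Lemma idtwist_rfree : bijective phi -> free_module (rmod (idtwist phi)).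
Proof.
case=> psi phiK psiK; exists unit, (fun=> (1 : B)); split=> [m|s c].
  exists [:: tt], (fun=> psi m).
  by rewrite big_seq1 rmod_scaleE idtwist_mactrE mul1r psiK.
case: s => [|[] [|[] s]] //= _.
rewrite big_seq1 rmod_scaleE idtwist_mactrE mul1r => c0 [] _.
by apply: (can_inj phiK); rewrite c0 rmorph0.
Qed.
End FreeTwist.

(** * Ring extensions with a finite basis of normalising elements *)

Section NormalizingBasis.
Variables (R S : pzRingType) (i : {rmorphism R -> S}) (I : finType).
Variables (u : I -> S) (phi : I -> {rmorphism R -> R}) (c : I -> S -> R).
Hypothesis uphi : forall j r, u j * i r = i (phi j r) * u j.
Hypothesis cK : forall x, \sum_j i (c j x) * u j = x.
Hypothesis Kc : forall (r : I -> R) j, c j (\sum_l i (r l) * u l) = r j.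

(** Coordinates are unique by [Kc], so it suffices to exhibit an expansion of the left-hand
    argument. *)
Lemma coord_linear j r x y : c j (i r * x + y) = r * c j x + c j y.
Proof.
rewrite -{1}(cK x) -{1}(cK y) mulr_sumr -big_split /=.
rewrite -[RHS](Kc (fun l => r * c l x + c l y)); congr (c j _).
by apply: eq_bigr => l _; rewrite mulrA -rmorphM -mulrDl -rmorphD.
Qed.

(** Moving $r$ leftwards past $u_l$ turns it into $\phi_l(r)$; this is where the twisted right
    action on each summand comes from. *)
Lemma coord_mulr j x r : c j (x * i r) = c j x * phi j r.
Proof.
rewrite -{1}(cK x) mulr_suml -[RHS](Kc (fun l => c l x * phi l r)).
by congr (c j _); apply: eq_bigr => l _; rewrite -mulrA uphi mulrA -rmorphM.
Qed.

Lemma coordD j x y : c j (x + y) = c j x + c j y.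
Proof. by have := coord_linear j 1 x y; rewrite rmorph1 !mul1r. Qed.

Lemma coord_basis j l : c j (u l) = (j == l)%:R.
Proof.
rewrite -(Kc (fun j => (j == l)%:R)); congr (c j _).
rewrite (bigD1 l) //= eqxx rmorph1 mul1r big1 ?addr0 // => m /negPf->.
by rewrite rmorph0 mul0r.
Qed.

Lemma normalizing_basis_isom :
  bimod_isom (restr i) (dsum (fun j => idtwist (phi j))).
Proof.
pose f (x : restr i) : dsum (fun j => idtwist (phi j)) := [ffun j => c j x].
have fl : linear f.
  move=> r x y; apply/ffunP => j.
  by rewrite dsum_addE dsum_scaleE !ffunE; exact: coord_linear.
pose fm := GRing.isLinear.Build _ _ _ _ f fl.
exists (HB.pack f fm : {linear restr i -> dsum (fun j => idtwist (phi j))}).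
split=> [|x r].
  exists (fun v : dsum (fun j => idtwist (phi j)) => \sum_j i (v j) * u j)
    => [x|v] /=.
    by rewrite -[RHS]cK; apply: eq_bigr => j _; rewrite ffunE.
  by apply/ffunP => j; rewrite ffunE Kc.
by apply/ffunP => j; rewrite dsum_mactrE /= !ffunE; exact: coord_mulr.
Qed.

Lemma normalizing_basis_faithfully_flat_left (i0 : I) :
  faithfully_flat_left (restr i).
Proof.
have cl j : linear (c j : restr i -> R^o) by move=> r x y; exact: coord_linear.
pose cm j := GRing.isLinear.Build _ _ _ _ (c j : restr i -> R^o) (cl j).
pose C j : {linear restr i -> R^o} := HB.pack (c j : restr i -> R^o) (cm j).
apply: (@finite_free_faithfully_flat_left _ _ _ i0 (u : I -> restr i) C)
  => [m|j l].
  exact: cK.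
exact: coord_basis.
Qed.

(** Since $\phi_j(r)u_j=u_jr$, the $u_j$ are also a right basis, with coordinates
    $\phi_j^{-1}(c_j(x))$. *)
Lemma normalizing_basis_faithfully_flat_right (i0 : I) :
  (forall j, bijective (phi j)) ->
  faithfully_flat_right (rmod (restr i)).
Proof.
move=> phibij.
have /choice[psi psiP] j : exists psi, cancel (phi j) psi /\ cancel psi (phi j).
  by case: (phibij j) => psi; exists psi.
pose d j (x : rmod (restr i)) : R^c^o := psi j (c j x).
have dl j : linear (d j).
  move=> r x y; have [phiK psiK] := psiP j; apply: (can_inj phiK).
  rewrite rmorphD rmorphM /d !psiK coordD; congr (_ + _); exact: coord_mulr.
pose dm j := GRing.isLinear.Build _ _ _ _ (d j) (dl j).
pose D j : {linear rmod (restr i) -> R^c^o} := HB.pack (d j) (dm j).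
apply: (@finite_free_faithfully_flat_right _ _ _ i0
  (u : I -> rmod (restr i)) D) => [m|j l].
  rewrite -[RHS]cK; apply: eq_bigr => j _.
  by rewrite rmod_scaleE restr_mactrE uphi /= /d (psiP j).2.
rewrite /= /d coord_basis; apply: (can_inj (psiP j).1).
by rewrite (psiP j).2 rmorph_nat.
Qed.
End NormalizingBasis.

(** * The automorphisms $\phi_g$ and the coordinates of $AG_\mu$ over $A^{G,\mu}$ *)

Section TwistDecomposition.
Variables (k : fieldType) (gT : finGroupType) (A : algType k).
Variables (charG : [pchar k]^'.-nat #|gT|).
Variables (to : {action gT &-> A}) (toP : is_alg_action to).
Variables (chi : gT -> gT -> k) (chiP : is_dual_iso chi).
Variables (mu : gT -> gT -> k) (muP : is_cocycle2 mu).
Local Notation B := (cotwist charG toP chiP muP).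
Local Notation AG := (twgrp A muP).
Local Notation pr := (gproj to chi).
Local Notation iB := (ct_emb charG toP chiP muP).
Local Notation u := (fun g : gT => tw_delta muP g (1 : A)).

Lemma gproj_gproj g h a : pr h (pr g a) = if h == g then pr g a else 0.
Proof. exact/(gproj_id charG chiP)/(gproj_grcomp toP chiP). Qed.

Lemma gprojZ h c a : pr h (c *: a) = c *: pr h a.
Proof. exact: (scalable_linear (gproj_linear chi toP h)). Qed.

Lemma gproj_bigsum h (a : gT -> A) : pr h (\sum_g a g) = \sum_g pr h (a g).
Proof.
pose fm := GRing.isLinear.Build _ _ _ _ (pr h) (gproj_linear chi toP h).
exact: (raddf_sum (HB.pack (pr h) fm : {linear A -> A})).
Qed.

Lemma gproj_sum_scale (w : gT -> k) (a : gT -> A) h :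
  pr h (\sum_g w g *: pr g (a g)) = w h *: pr h (a h).
Proof.
rewrite gproj_bigsum (bigD1 h) //= gprojZ gproj_gproj eqxx.
rewrite big1 ?addr0 // => g /negPf ne.
by rewrite gprojZ gproj_gproj eq_sym ne scaler0.
Qed.

Definition graded_scale (w : gT -> k) (a : B) : B := \sum_h w h *: pr h a.

Lemma gproj_graded_scale w h a : pr h (graded_scale w a) = w h *: pr h a.
Proof. exact: gproj_sum_scale. Qed.

Lemma gproj_inj (a b : A) : (forall h, pr h a = pr h b) -> a = b.
Proof.
move=> ab; rewrite -(gproj_sum to charG chiP a) -(gproj_sum to charG chiP b).
by apply: eq_bigr => h _.
Qed.

Lemma graded_scaleK w : (forall h, w h != 0) ->
  cancel (graded_scale w) (graded_scale (fun h => (w h)^-1)).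
Proof.
move=> w0 a; apply: gproj_inj => h; rewrite !gproj_graded_scale scalerA.
by rewrite mulVf // scale1r.
Qed.

Fact graded_scale_linear w : linear (graded_scale w).
Proof.
move=> c a b; apply: gproj_inj => h.
rewrite gproj_graded_scale !(gproj_linear chi toP) !gproj_graded_scale.
by rewrite scalerDr [in LHS]scalerA [in RHS]scalerA mulrC.
Qed.

Lemma mu_neq0 g h : mu g h != 0. Proof. by case: muP. Qed.

(** The element $u_g$ has the right inverse $\mu(g,g^{-1})^{-1}u_{g^{-1}}$. *)
Lemma mul_delta_inj g (x y : AG) : x * u g = y * u g -> x = y.
Proof.
have uu : u g * ((mu g g^-1%g)^-1 *: u g^-1%g) = 1.
  rewrite -scalerAr tw_deltaM mulr1 mulgV; apply/ffunP => l; rewrite !ffunE.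
  by case: eqP; rewrite ?scaler0 // scalerA mulVf ?mu_neq0 ?scale1r.
move/(congr1 ( *%R^~ ((mu g g^-1%g)^-1 *: u g^-1%g))).
by rewrite -!mulrA uu !mulr1.
Qed.

Hypothesis abelG : abelian [set: gT].

Lemma abelC (g h : gT) : (g * h = h * g)%g.
Proof. by apply: (centsP abelG); rewrite inE. Qed.

(** The commutator bicharacter of $\mu$: $u_gu_h$ is this scalar times $u_hu_g$. *)
Definition twist_weight g h := mu g h / mu h g.
Definition twist_aut g := graded_scale (twist_weight g).

Lemma twist_weight_neq0 g h : twist_weight g h != 0.
Proof. by rewrite mulf_neq0 ?invr_neq0 ?mu_neq0. Qed.

Lemma ct_emb_mul_delta (b : B) g l :
  (iB b * u g) l = mu (l * g^-1)%g g *: pr (l * g^-1)%g b.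
Proof.
rewrite twgrp_mulE (bigD1 (l * g^-1)%g) //= big1 => [|h ne].
  by rewrite !ffunE invMg invgK mulgKV eqxx mulr1 addr0.
rewrite !ffunE; case: eqP => [e|_]; last by rewrite mulr0 scaler0.
by case/eqP: ne; rewrite -e invMg invgK mulKVg.
Qed.

(** On a component $b_h\otimes h$ the left side gives the factor $\mu(g,h)$ at $gh$. On the right,
    multiplication by $u_g$ gives $\mu(h,g)$ at $hg=gh$, which cancels the denominator of the
    weight. *)
Lemma delta_mul_ct_emb g (b : B) : u g * iB b = iB (twist_aut g b) * u g.
Proof.
apply/ffunP => l; rewrite ct_emb_mul_delta gproj_graded_scale scalerA.
rewrite twgrp_mulE (bigD1 g) //= big1 => [|h ne]; last first.
  by rewrite !ffunE (negPf ne) mul0r scaler0.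
rewrite !ffunE eqxx mul1r addr0 (abelC l) mulrC divfK //; exact: mu_neq0.
Qed.

(** As $u_g$ can be cancelled, $u_gb=\phi_g(b)u_g$ determines $\phi_g(b)$, and multiplicativity
    follows from $u_gab=\phi_g(a)u_gb=\phi_g(a)\phi_g(b)u_g$. *)
Fact twist_aut_monoid g : monoid_morphism (twist_aut g).
Proof.
have inj a b : iB a * u g = iB b * u g -> a = b.
  by move/mul_delta_inj/ct_emb_inj.
split=> [|a b]; apply: inj.
  by rewrite -delta_mul_ct_emb rmorph1 mulr1 mul1r.
rewrite -delta_mul_ct_emb !rmorphM mulrA delta_mul_ct_emb -!mulrA.
by rewrite delta_mul_ct_emb.
Qed.

Definition twist_lrmorphism g : {lrmorphism B -> B} :=
  HB.pack (twist_aut g)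
    (GRing.isLinear.Build k B B _ (twist_aut g)
      (graded_scale_linear (twist_weight g)))
    (GRing.isMonoidMorphism.Build B B (twist_aut g) (twist_aut_monoid g)).

Lemma twist_aut_bij g : bijective (twist_aut g).
Proof.
exists (graded_scale (fun h => (twist_weight g h)^-1)).
  exact/graded_scaleK/twist_weight_neq0.
move=> a; apply: gproj_inj => h; rewrite !gproj_graded_scale scalerA.
by rewrite mulfV ?scale1r ?twist_weight_neq0.
Qed.

Lemma twist_aut1 : twist_aut 1%g =1 id.
Proof.
move=> a; apply: gproj_inj => h; rewrite gproj_graded_scale /twist_weight.
by case: muP => _ _ /(_ h)[-> ->]; rewrite divr1 scale1r.
Qed.

(** The coefficient of $u_g$: as $(b_h\otimes h)u_g=\mu(h,g)b_h\otimes hg$, its degree $h$ part is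
    read from the value of $x$ at $hg$. *)
Definition tw_coord (g : gT) (x : AG) : B :=
  \sum_h (mu h g)^-1 *: pr h (x (h * g)%g).

Lemma tw_coordK (x : AG) : \sum_g iB (tw_coord g x) * u g = x.
Proof.
apply/ffunP => l; rewrite sum_ffunE -[RHS](gproj_sum to charG chiP).
(* At $l$ the summand for $g$ contributes the part of $x(l)$ of degree $lg^{-1}$; as $g$ varies,
   every degree occurs once. *)
have bij : injective (fun g : gT => l * g^-1)%g by move=> g h /mulgI/invg_inj.
rewrite [RHS](reindex_inj bij); apply: eq_bigr => g _.
rewrite ct_emb_mul_delta gproj_sum_scale scalerA mulfV ?mu_neq0 //.
by rewrite scale1r mulgKV.
Qed.

(** At $hg$ the term $r_lu_l$ has degree $hgl^{-1}$, which equals $h$ only for $l=g$. *)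
Lemma tw_Kcoord (r : gT -> B) g : tw_coord g (\sum_h iB (r h) * u h) = r g.
Proof.
apply: gproj_inj => h; rewrite gproj_sum_scale sum_ffunE.
rewrite gproj_bigsum (bigD1 g) //= big1 => [|l ne].
  rewrite ct_emb_mul_delta mulgK gprojZ gproj_gproj eqxx addr0 scalerA.
  by rewrite mulVf ?mu_neq0 // scale1r.
rewrite ct_emb_mul_delta gprojZ gproj_gproj.
case: eqP => [e|_]; last exact: scaler0.
by case/eqP: ne; apply/(mulgI h); rewrite {1}e mulgKV.
Qed.
End TwistDecomposition.

(** * Application to the extensions of $A^{G,\mu}$ and of $A$ *)

Theorem lemma1p3 (k : closedFieldType) (gT : finGroupType)
    (abelG : abelian [set: gT]) (charG : [pchar k]^'.-nat #|gT|)
    (A : algType k) (to : {action gT &-> A}) (toP : is_alg_action to)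
    (chi : gT -> gT -> k) (chiP : is_dual_iso chi)
    (mu : gT -> gT -> k) (muP : is_cocycle2 mu) :
  let B : algType k := cotwist charG toP chiP muP in
  let AG : algType k := twgrp A muP in
  let iB : {rmorphism B -> AG} := ct_emb charG toP chiP muP in
  let iA : {rmorphism A -> AG} := base_emb A muP in
  (exists phi : gT -> {lrmorphism B -> B},
    [/\ forall g, bijective (phi g),
        phi 1%g =1 id,
        bimod_isom (restr iB) (dsum (fun g : gT => idtwist (phi g)))
      & forall g, free_module (idtwist (phi g)) /\
                  free_module (rmod (idtwist (phi g)))])
  /\
  [/\ faithfully_flat_left (restr iB), faithfully_flat_right (rmod (restr iB)),
      faithfully_flat_left (restr iA) & faithfully_flat_right (rmod (restr iA))].
Proof.
move=> B AG iB iA.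
pose phi g : {lrmorphism B -> B} := twist_lrmorphism charG toP chiP muP abelG g.
pose u (g : gT) : AG := tw_delta muP g (1 : A).
have phi_bij g : bijective (phi g) by exact: twist_aut_bij.
have uphi g r : u g * iB r = iB (phi g r) * u g by exact: delta_mul_ct_emb.
have cK (x : AG) : \sum_g iB (tw_coord charG toP chiP g x) * u g = x.
  exact: tw_coordK.
have Kc (r : gT -> B) g :
  tw_coord charG toP chiP g (\sum_h iB (r h) * u h) = r g.
  exact: tw_Kcoord.
have mu1 g : mu 1%g g = 1 /\ mu g 1%g = 1 by have [_ _] := muP.
(* Over $A$ the coordinates of $x$ are its values, and normalisation of $\mu$ makes each $u_g$
   commute with $A$. *)
have base_delta a g : iA a * u g = tw_delta muP g a.
  by rewrite tw_deltaM mul1g mulr1 (mu1 g).1 scale1r.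
have uA g a : u g * iA a = iA a * u g.
  by rewrite base_delta tw_deltaM mulg1 mul1r (mu1 g).2 scale1r.
have cKA (x : AG) : \sum_g iA (x g) * u g = x.
  by rewrite [RHS]twgrp_sum_delta; apply: eq_bigr => g _; rewrite base_delta.
have KcA (r : gT -> A) g : (\sum_h iA (r h) * u h : AG) g = r g.
  rewrite sum_ffunE (bigD1 g) //= base_delta ffunE eqxx big1 ?addr0 // => h.
  by rewrite base_delta ffunE eq_sym => /negPf->.
split.
  exists phi; split=> // [||g].
  - exact: twist_aut1.
  - exact: normalizing_basis_isom uphi cK Kc.
  - by split; [exact: idtwist_free | exact: idtwist_rfree (phi_bij g)].
split.
- exact: normalizing_basis_faithfully_flat_left cK Kc 1%g.
- exact: normalizing_basis_faithfully_flat_right uphi cK Kc 1%g phi_bij.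
- exact: (normalizing_basis_faithfully_flat_left
    (c := fun g (x : AG) => x g) cKA KcA 1%g).
(* Commutation with $A$ is the case of trivial normalising automorphisms. *)
- apply: (normalizing_basis_faithfully_flat_right (phi := fun=> idfun)
    (c := fun g (x : AG) => x g) uA cKA KcA 1%g).
  by move=> g; exists id.
Qed.
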